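(* There exists a permutation array $P\subset[4]^4$ which is not realized by any four complete flags in $K^4$, for any field $K$.
   Context: A complete flag in $K^n$ is a chain $E_\bullet=\{0=E_0\subset E_1\subset\cdots\subset E_n=K^n\}$ with $\dim E_i=i$. Let $[n]=\{1,\dots,n\}$. For $x,y\in[n]^d$ write $x\preceq y$ if $x_i\le y_i$ for all $i$; $\bigvee R$ is the coordinatewise maximum of a set $R$. A dot array is a subset $P\subset[n]^d$; $P[y]=\{x\in P:x\preceq y\}$. Put $\mathrm{rk}_jP=\#\{k\in[n]:\exists x\in P,\ x_j=k\}$. $P$ is rankable of rank $r$, written $\mathrm{rk}\,P=r$, if $\mathrm{rk}_jP=r$ for all $j$; it is totally rankable if every $P[y]$ is rankable. A position $x$ is redundant in $P$ if there is $R\subset P$ with $x=\bigvee R$, $\#R>1$, and every $y\in R$ has some coordinate $y_i=x_i$. A permutation array in $[n]^d$ is a totally rankable dot array of rank $n$ no element of which is redundant. A permutation array $P\subset[n]^d$ is realized over $K$ by complete flags $E^1_\bullet,\dots,E^d_\bullet$ in $K^n$ if $\dim(E^1_{x_1}\cap\cdots\cap E^d_{x_d})=\mathrm{rk}\,P[x]$ for all $x\in[n]^d$. *)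

(* Defs.v *)
From mathcomp Require Import all_boot all_order all_algebra.

Set Implicit Arguments.
Unset Strict Implicit.
Unset Printing Implicit Defensive.

(* Positions in [n]^d.  Coordinates are shifted by one: the value k : 'I_n
   stands for the element k.+1 of [n] = {1, ..., n}. *)
Definition position (n d : nat) := {ffun 'I_d -> 'I_n}.

Section DotArrays.

Variables n d : nat.
Implicit Types (x y : position n d) (P R : {set position n d}) (j : 'I_d).

Definition pos_le x y : bool := [forall i, x i <= y i].

Definition principal_sub P y : {set position n d} := [set x in P | pos_le x y].

Definition rk_dir j P : nat := #|[set x j | x : position n d in P]|.

Definition has_rank P (r : nat) : Prop := forall j, rk_dir j P = r.

Definition rankable P : Prop := exists r, has_rank P r.

Definition totally_rankable P : Prop := forall y, rankable (principal_sub P y).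

(* The maximum is taken in nat, so that no default element of 'I_n is needed;
   it is only used for nonempty R. *)
Definition is_join x R : Prop := forall i, \max_(y in R) y i = x i :> nat.

Definition redundant P x : Prop :=
  exists R, [/\ R \subset P, is_join x R, 1 < #|R|
              & forall y, y \in R -> exists i, y i = x i].

Definition permutation_array P : Prop :=
  [/\ totally_rankable P, has_rank P n
    & forall x, x \in P -> ~ redundant P x].

End DotArrays.

Section Flags.

Variables (K : fieldType) (n : nat).

Definition complete_flag (E : 'I_n.+1 -> {vspace 'rV[K]_n}) : Prop :=
  [/\ E ord0 = 0%VS, E ord_max = fullv,
      forall i j : 'I_n.+1, i <= j -> (E i <= E j)%VS
    & forall i : 'I_n.+1, \dim (E i) = i].

(* [lift ord0 k] is the element k.+1 of 'I_n.+1, which undoes the shift of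
   coordinates. *)
Definition realized_by d (P : {set position n d})
    (E : 'I_d -> 'I_n.+1 -> {vspace 'rV[K]_n}) : Prop :=
  forall x : position n d,
    has_rank (principal_sub P x) (\dim (\bigcap_(i < d) E i (lift ord0 (x i)))%VS).

End Flags.

(* Main.v *)
Require Import Defs.
From mathcomp Require Import all_boot all_order all_algebra.

(** The array is the combinatorial shadow of an impossible configuration of
    four lines L0, L1, L2, L3 in projective 3-space: every two of them meet,
    except L2 and L3, and no three are concurrent.  It is impossible because
    L0 and L1 span a plane, and a line that meets both of them in distinct
    points lies in that plane; so L2 and L3 are coplanar and have to meet.

    Give each line the role of the two-dimensional member of a flag, let all
    other intersections of flag members have the dimension
    max(0, x_0 + ... + x_3 - 12) of general position (x counted from 1), and
    take the positions where this prescribed dimension drops in each of the four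
    directions, omitting the redundant ones.  The 15 positions that remain
    determine the prescribed dimensions as their ranks.

    The geometric half is the linear algebra fact [crossing_planes_meet], which
    [skew_array_not_realized] confronts with the ranks of the array.  The
    combinatorial half is a finite verification: [rk_dir_skew] reduces ranks to
    a computation on words over {0, 1, 2, 3}, and redundancy is excluded by
    [antichain_irredundant], as the 15 dots are pairwise incomparable. *)

Set Implicit Arguments.
Unset Strict Implicit.
Unset Printing Implicit Defensive.

Section LinesInAPlane.

Variables (K : fieldType) (V : vectType K).
Implicit Types A B C D : {vspace V}.

(** Projectively: a line that meets two others in distinct points is spanned by
    these points. *)
Lemma sub_addv_of_two_points A B C :
    \dim C = 2 -> \dim (A :&: C) = 1 -> \dim (B :&: C) = 1 ->
    \dim (A :&: B :&: C) = 0 ->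
  (C <= A + B)%VS.
Proof.
move=> dC dAC dBC dABC.
have sC : (A :&: C + B :&: C <= C)%VS by rewrite subv_add !capvSr.
have -> : C = (A :&: C + B :&: C)%VS.
  apply/esym/eqP; rewrite eqEdim sC dC /=.
  have := dimv_sum_cap (A :&: C) (B :&: C).
  have -> : (A :&: C :&: (B :&: C) = A :&: B :&: C)%VS.
    by rewrite (capvC B) -capvA (capvA C) capvv (capvC C) capvA.
  by rewrite dAC dBC dABC addn0 => ->.
by rewrite addvS ?capvSl.
Qed.

Lemma crossing_planes_meet A B C D :
    \dim A = 2 -> \dim B = 2 -> \dim C = 2 -> \dim D = 2 ->
    \dim (A :&: B) = 1 ->
    \dim (A :&: C) = 1 -> \dim (B :&: C) = 1 -> \dim (A :&: B :&: C) = 0 ->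
    \dim (A :&: D) = 1 -> \dim (B :&: D) = 1 -> \dim (A :&: B :&: D) = 0 ->
  0 < \dim (C :&: D).
Proof.
move=> dA dB dC dD dAB dAC dBC dABC dAD dBD dABD.
have sCAB := sub_addv_of_two_points dC dAC dBC dABC.
have sDAB := sub_addv_of_two_points dD dAD dBD dABD.
have dimAB : \dim (A + B) = 3.
  by have := dimv_sum_cap A B; rewrite dA dB dAB addn1 => -[].
have : \dim (C + D) <= 3 by rewrite -dimAB dimvS // subv_add sCAB sDAB.
have := dimv_sum_cap C D; rewrite dC dD.
by case: (\dim (C :&: D)) => //; rewrite addn0 => ->.
Qed.

End LinesInAPlane.

(** Any set R witnessing that x is redundant lies below x, so it is contained in
    [set x] as soon as the dots are pairwise incomparable. *)
Lemma antichain_irredundant n d (P : {set position n d}) :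
    (forall x y, x \in P -> y \in P -> pos_le y x -> y = x) ->
  forall x, x \in P -> ~ redundant P x.
Proof.
move=> antiP x Px [R [sRP joinR R_gt1 _]].
have/subset_leq_card : R \subset [set x].
  apply/subsetP=> y Ry; rewrite inE; apply/eqP/antiP => //.
    exact: (subsetP sRP).
  by apply/forallP=> i; rewrite -(joinR i) (bigmax_sup y).
by rewrite cards1 leqNgt R_gt1.
Qed.

(** Finite sets and finite functions do not reduce well in the kernel, so
    positions are replaced by their words of values. *)
Definition word (x : position 4 4) : seq nat := [seq (x i : nat) | i <- enum 'I_4].

Definition position_of (s : seq nat) : position 4 4 := [ffun i : 'I_4 => inord (nth 0 s i)].

Definition is_word (s : seq nat) : bool := (size s == 4) && all (ltn^~ 4) s.

Definition words : seq (seq nat) :=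
  [seq a :: s | a <- iota 0 4, s <- [seq b :: t | b <- iota 0 4,
    t <- [seq [:: c; e] | c <- iota 0 4, e <- iota 0 4]]].

Lemma nth_word x (i : 'I_4) : nth 0 (word x) i = x i.
Proof. by rewrite (nth_map i) ?size_enum_ord // nth_ord_enum. Qed.

Lemma word_inj : injective word.
Proof. by move=> x y exy; apply/ffunP=> i; apply: val_inj; rewrite /= -!nth_word exy. Qed.

Lemma is_word_word x : is_word (word x).
Proof.
rewrite /is_word size_map size_enum_ord eqxx /=.
by apply/allP=> _ /mapP[i _ ->] /=.
Qed.

Lemma position_ofK s : is_word s -> word (position_of s) = s.
Proof.
case/andP=> /eqP size_s /allP s_lt4; apply: (@eq_from_nth _ 0).
  by rewrite size_map size_enum_ord size_s.
move=> i; rewrite size_map size_enum_ord => lti4.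
rewrite (nth_word _ (Ordinal lti4)) ffunE inordK //.
by apply: s_lt4; rewrite mem_nth ?size_s.
Qed.

Lemma mem_words s : is_word s -> s \in words.
Proof.
case: s => [|a [|b [|c [|e [|? ?]]]]] //; rewrite /is_word /= andbT.
case/and4P=> lta ltb ltc lte.
by do 3 (apply: allpairs_f; first by rewrite mem_iota); rewrite mem_iota.
Qed.

Definition word_le (s t : seq nat) : bool :=
  all (fun i => nth 0 s i <= nth 0 t i) (iota 0 4).

Lemma pos_le_word x y : pos_le x y = word_le (word x) (word y).
Proof.
apply/forallP/allP=> [lexy i | lexy i].
  rewrite mem_iota => /= lti4.
  by rewrite (nth_word x (Ordinal lti4)) (nth_word y (Ordinal lti4)).
by rewrite -!nth_word lexy // mem_iota /=.
Qed.

(** One dot for each one-dimensional flag member, for each of the five prescribed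
    intersection points of two lines, for each intersection point of three planes,
    and two, [:: 3; 3; 1; 2] and [:: 3; 3; 2; 1], for the points where one
    of the disjoint lines L2 and L3 crosses the plane of the other flag. *)
Definition skew_dots : seq (seq nat) :=
  [:: [:: 0; 3; 3; 3]; [:: 3; 0; 3; 3]; [:: 3; 3; 0; 3]; [:: 3; 3; 3; 0];
      [:: 1; 1; 3; 3]; [:: 1; 3; 1; 3]; [:: 1; 3; 3; 1]; [:: 3; 1; 1; 3];
      [:: 3; 1; 3; 1];
      [:: 2; 2; 2; 3]; [:: 2; 2; 3; 2]; [:: 2; 3; 2; 2]; [:: 3; 2; 2; 2];
      [:: 3; 3; 1; 2]; [:: 3; 3; 2; 1]].

Definition skew_array : {set position 4 4} := [set x | word x \in skew_dots].

Definition word_rk (j : nat) (t : seq nat) : nat :=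
  count (fun k => has (fun s => word_le s t && (nth 0 s j == k)) skew_dots) (iota 0 4).

Lemma rk_dir_skew (y : position 4 4) (j : 'I_4) :
  rk_dir j (principal_sub skew_array y) = word_rk j (word y).
Proof.
rewrite /rk_dir /word_rk -val_enum_ord count_map -size_filter enumT cardE /enum_mem.
congr (size _); apply: eq_filter => k; apply/imsetP/hasP.
  case=> x; rewrite !in_set pos_le_word => /andP[dot_x le_xy] ->.
  by exists (word x); rewrite // le_xy nth_word /=.
case=> s dot_s /andP[le_sy /eqP sj].
have /position_ofK sK : is_word s.
  by have /allP := (erefl : all is_word skew_dots); apply.
exists (position_of s); first by rewrite !in_set pos_le_word sK dot_s.
by apply: val_inj; rewrite /= -nth_word sK sj.
Qed.

Lemma skew_array_totally_rankable : totally_rankable skew_array.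
Proof.
move=> y; exists (word_rk 0 (word y)) => j; rewrite rk_dir_skew.
have /allP/(_ _ (mem_words (is_word_word y)))/allP/(_ j) :
    all (fun t => all (fun i => word_rk i t == word_rk 0 t) (iota 0 4)) words.
  by vm_compute.
by rewrite mem_iota => /(_ (ltn_ord j))/eqP.
Qed.

Lemma skew_array_rank : has_rank skew_array 4.
Proof.
pose top := position_of [:: 3; 3; 3; 3].
have <- : principal_sub skew_array top = skew_array.
  apply/setP=> x; rewrite !in_set pos_le_word position_ofK //.
  apply/andb_idr=> dot_x.
  by have /allP := (erefl : all (word_le^~ [:: 3; 3; 3; 3]) skew_dots); apply.
by move=> j; rewrite rk_dir_skew position_ofK //; case: j => -[|[|[|[|]]]].
Qed.

Lemma skew_array_permutation : permutation_array skew_array.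
Proof.
split; [exact: skew_array_totally_rankable | exact: skew_array_rank |].
apply: antichain_irredundant => x y; rewrite !in_set pos_le_word => dot_x dot_y le_yx.
have /allP/(_ _ dot_x)/allP/(_ _ dot_y) :
    all (fun s => all (fun t => word_le t s ==> (t == s)) skew_dots) skew_dots.
  by vm_compute.
by rewrite le_yx => /eqP/word_inj.
Qed.

Section Realization.

Variables (K : fieldType) (E : 'I_4 -> 'I_5 -> {vspace 'rV[K]_4}).
Hypotheses (flagE : forall k, complete_flag (E k)) (realE : realized_by skew_array E).

(** Flag members indexed by letters: [a] stands for dimension [a.+1], so that
    [member k 1] is the line L_k. *)
Let member (k : nat) (a : nat) : {vspace 'rV[K]_4} := E (inord k) (inord a.+1).

Lemma dim_cap_members a b c e : is_word [:: a; b; c; e] ->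
  \dim (member 0 a :&: member 1 b :&: member 2 c :&: member 3 e)
    = word_rk 0 [:: a; b; c; e].
Proof.
move=> w; have := realE (position_of [:: a; b; c; e]) ord0.
rewrite rk_dir_skew (position_ofK w) => ->; congr (\dim _).
case/andP: (w) => _ /allP lt4.
have memberE (i : 'I_4) : E i (lift ord0 (position_of [:: a; b; c; e] i))
    = member i (nth 0 [:: a; b; c; e] i).
  rewrite /member inord_val ffunE; congr (E _ _); apply: val_inj.
  have lt_i : nth 0 [:: a; b; c; e] i < 4 by apply: lt4; rewrite mem_nth.
  by rewrite /= !inordK.
by rewrite !big_ord_recl big_ord0 capvf !memberE /= !capvA.
Qed.

Lemma member_full k : member k 3 = fullv.
Proof.
have [_ Efull _ _] := flagE (inord k); rewrite -Efull /member.
by congr (E _ _); apply: val_inj; rewrite /= inordK.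
Qed.

Lemma dim_line k : \dim (member k 1) = 2.
Proof. by have [_ _ _ ->] := flagE (inord k); rewrite inordK. Qed.

Lemma skew_array_not_realized : False.
Proof.
have dim := dim_cap_members.
have := dim 3 3 1 1 erefl.
rewrite !member_full !(capvf, capfv) => dim23.
suff : 0 < \dim (member 2 1 :&: member 3 1) by rewrite dim23.
(* Intersections of fewer than four lines: the other flags contribute the
   whole space. *)
have := dim 1 1 3 3 erefl; have := dim 1 3 1 3 erefl.
have := dim 1 3 3 1 erefl; have := dim 3 1 1 3 erefl.
have := dim 3 1 3 1 erefl; have := dim 1 1 1 3 erefl.
have := dim 1 1 3 1 erefl.
rewrite !member_full !(capvf, capfv) => *.
by apply: (@crossing_planes_meet _ _ (member 0 1) (member 1 1)); rewrite ?dim_line.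
Qed.

End Realization.

Theorem mainTheorem7 :
  exists P : {set position 4 4},
    permutation_array P /\
    forall (K : fieldType) (E : 'I_4 -> 'I_5 -> {vspace 'rV[K]_4}),
      (forall k : 'I_4, complete_flag (E k)) -> ~ realized_by P E.
Proof.
exists skew_array; split; first exact: skew_array_permutation.
by move=> K E flagE; apply: skew_array_not_realized.
Qed.
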